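(* Let $(d_n)_{n\ge1}$ be a fixed sequence of integers $d_n\ge2$. For every $c\in\{0,1,\dots,d_1-1\}$ the shift mapping $\hat\varphi$ is decreasing on the first rank interval $\nabla^{-D}_c=(\inf\Delta^{-D}_c;\sup\Delta^{-D}_c)$.
   Context: $A_{d_n}=\{0,1,\dots,d_n-1\}$, $a_0=\sum_{n=1}^{\infty}\frac{(-1)^{n+1}}{d_1\cdots d_n}$. For digits $\varepsilon_n\in A_{d_n}$ put $\Delta^{-D}_{\varepsilon_1\varepsilon_2\ldots}=\sum_{n=1}^{\infty}\frac{(-1)^n\varepsilon_n}{d_1d_2\cdots d_n}$; every number of $[a_0-1;a_0]$ has such a representation (some numbers have two; then one of the two is fixed and digits are read from it). The cylinder $\Delta^{-D}_c$ is the set of numbers in $[a_0-1;a_0]$ having a representation with first digit $\varepsilon_1=c$. The shift mapping $\hat\varphi$ on $[a_0-1;a_0]$ is $$\hat\varphi\left(\Delta^{-D}_{\varepsilon_1\varepsilon_2\varepsilon_3\ldots}\right)=\sum_{n=2}^{\infty}\frac{(-1)^{n-1}\varepsilon_n}{d_2d_3\cdots d_n}.$$ *)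

(* Defs.v *)
From mathcomp Require Import all_boot all_order all_algebra.
From mathcomp Require Import all_classical all_reals all_analysis.

Set Implicit Arguments.
Unset Strict Implicit.
Unset Printing Implicit Defensive.

Import Order.TTheory GRing.Theory Num.Theory.
Import numFieldNormedType.Exports.

Local Open Scope classical_set_scope.
Local Open Scope ring_scope.

(* Sequences of bases [d] and of digits [e] are indexed from 1;
   their values at 0 are never used. *)

Definition nega_digits (d e : nat -> nat) : Prop :=
  forall n : nat, (1 <= n)%N -> (e n < d n)%N.

Definition a0 (R : realType) (d : nat -> nat) : R :=
  limn (fun N => \sum_(1 <= n < N)
    (-1) ^+ n.+1 / (\prod_(1 <= i < n.+1) d i)%N%:R : R).

Definition nega_value (R : realType) (d e : nat -> nat) : R :=
  limn (fun N => \sum_(1 <= n < N)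
    (-1) ^+ n * (e n)%:R / (\prod_(1 <= i < n.+1) d i)%N%:R : R).

Definition nega_repr (R : realType) (d e : nat -> nat) (x : R) : Prop :=
  nega_digits d e /\ nega_value R d e = x.

Definition cylinder (R : realType) (d : nat -> nat) (c : nat) : set R :=
  [set x | x \in `[a0 R d - 1, a0 R d] /\
           exists e : nat -> nat, nega_repr d e x /\ e 1%N = c].
Arguments cylinder R d c : clear implicits.

(* [dig x] is the representation of [x] from which the digits of [x] are read;
   when [x] has two representations, either one may be the selected one.
   Existence of a representation is not assumed: such a [dig] always exists
   by choice. *)
Definition digit_selection (R : realType) (d : nat -> nat)
    (dig : R -> nat -> nat) : Prop :=
  forall x : R, x \in `[a0 R d - 1, a0 R d] ->
    (exists e : nat -> nat, nega_repr d e x) -> nega_repr d (dig x) x.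

(* The shift is meaningful on [a0 - 1; a0] only; elsewhere the value is
   irrelevant. *)
Definition shift_map (R : realType) (d : nat -> nat)
    (dig : R -> nat -> nat) (x : R) : R :=
  limn (fun N => \sum_(2 <= n < N)
    (-1) ^+ n.-1 * (dig x n)%:R / (\prod_(2 <= i < n.+1) d i)%N%:R : R).

(* Main.v *)
Require Import Defs.
From mathcomp Require Import all_boot all_order all_algebra.
From mathcomp Require Import all_classical all_reals all_analysis.
From mathcomp Require Import ring lra.

Import Order.TTheory GRing.Theory Num.Theory.
Import numFieldNormedType.Exports.

Local Open Scope classical_set_scope.
Local Open Scope ring_scope.

(** The numbers [x] having a representation with first digit [k] satisfy
    [x = - (k + v) / d_1], where [v] is the value of the remaining digits over
    the shifted bases [d_2, d_3, ...], and [shift_map d dig x] is [v] for the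
    selected representation. Hence [shift_map d dig x = - k - d_1 x]
    ([shift_mapE]), which is decreasing as long as the first digit [k] of [x]
    does not change. It remains to see that every [x] of the open interval has
    [c] as its selected first digit.

    All values over the shifted bases lie in an interval of length [1],
    [[a - 1; a]] with [a] the number [a0] of these bases ([nega_value_itv]).
    Numbers with first digit [k] thus lie in
    [[(- k - a) / d_1; (1 - k - a) / d_1]] ([first_digit_itv]), and for distinct
    [k] these intervals have disjoint interiors. The open interval of the
    theorem is inside the interior of the one attached to [c], so any
    representation of any of its points starts with [c].

    The selected digits do represent [x] because some representation of [x]
    exists ([nega_repr_exists]): a greedy choice keeps each remainder in the
    interval [[a0 - 1; a0]] of the successive shifted bases, and bounded
    remainders are washed out by the factor [1 / (d_1 ... d_n)]. *)

(** * Bases, denominators and partial sums *)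

(** Admissible bases: [d_n >= 2] for all [n >= 1]. *)
Definition base_seq (d : nat -> nat) : Prop :=
  forall n : nat, (1 <= n)%N -> (2 <= d n)%N.

(** The denominator [d_1 ... d_n]. *)
Definition dprod (d : nat -> nat) (n : nat) : nat :=
  (\prod_(1 <= i < n.+1) d i)%N.

(** The [n]-th term of the nega-D expansion, [n >= 1]. *)
Definition nega_term (R : realType) (d e : nat -> nat) (n : nat) : R :=
  (-1) ^+ n * (e n)%:R / (dprod d n)%:R.

(** The sum of the first [N] terms, those of index [1], ..., [N]. *)
Definition nega_psum (R : realType) (d e : nat -> nat) (N : nat) : R :=
  \sum_(1 <= n < N.+1) nega_term R d e n.

Lemma base_seq_shift (d : nat -> nat) :
  base_seq d -> base_seq (fun n => d n.+1).
Proof. by move=> hd n _; apply: hd. Qed.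

Lemma nega_digits_shift (d e : nat -> nat) :
  nega_digits d e -> nega_digits (fun n => d n.+1) (fun n => e n.+1).
Proof. by move=> he n _; apply: he. Qed.

Lemma dprod0 (d : nat -> nat) : dprod d 0 = 1%N.
Proof. by rewrite /dprod big_geq. Qed.

Lemma dprodS (d : nat -> nat) (n : nat) :
  dprod d n.+1 = (dprod d n * d n.+1)%N.
Proof. by rewrite /dprod big_nat_recr. Qed.

Lemma dprod_recl (d : nat -> nat) (n : nat) :
  dprod d n.+1 = (d 1 * dprod (fun i => d i.+1) n)%N.
Proof. by rewrite /dprod big_nat_recl. Qed.

Lemma base_gt0 (R : realType) (d : nat -> nat) (n : nat) :
  base_seq d -> (1 <= n)%N -> 0 < (d n)%:R :> R.
Proof. by move=> hd n1; rewrite ltr0n; apply: leq_trans (hd n n1). Qed.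

Lemma dprod_gt0 (R : realType) (d : nat -> nat) (n : nat) :
  base_seq d -> 0 < (dprod d n)%:R :> R.
Proof.
move=> hd; elim: n => [|n IH]; first by rewrite dprod0.
by rewrite dprodS natrM mulr_gt0 // base_gt0.
Qed.

Lemma nega_psum0 (R : realType) (d e : nat -> nat) : nega_psum R d e 0 = 0.
Proof. by rewrite /nega_psum big_geq. Qed.

Lemma nega_psumS (R : realType) (d e : nat -> nat) (N : nat) :
  nega_psum R d e N.+1 = nega_psum R d e N + nega_term R d e N.+1.
Proof. by rewrite /nega_psum big_nat_recr. Qed.

Lemma nega_psum_series (R : realType) (d e : nat -> nat) :
  nega_psum R d e = series (fun n => nega_term R d e n.+1).
Proof.
by apply/funext => N; rewrite /nega_psum /series /= big_add1.
Qed.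

(** * Convergence *)

(** Each term is dominated in absolute value by the telescoping difference
    [1 / (d_1 ... d_n) - 1 / (d_1 ... d_(n+1))]. *)
Lemma nega_digit_le (R : realType) (d e : nat -> nat) (n : nat) :
  base_seq d -> nega_digits d e ->
  (e n.+1)%:R / (dprod d n.+1)%:R
    <= (dprod d n)%:R^-1 - (dprod d n.+1)%:R^-1 :> R.
Proof.
move=> hd he.
have P0 : 0 < (dprod d n)%:R :> R := dprod_gt0 R d n hd.
have d0 : 0 < (d n.+1)%:R :> R := base_gt0 R d n.+1 hd isT.
have lt_ed : (e n.+1)%:R + 1 <= (d n.+1)%:R :> R.
  by rewrite natr1 ler_nat he.
rewrite dprodS natrM.
have -> : (dprod d n)%:R^-1 - ((dprod d n)%:R * (d n.+1)%:R)^-1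
  = ((d n.+1)%:R - 1) / ((dprod d n)%:R * (d n.+1)%:R) :> R.
  by field; rewrite !gt_eqF.
by apply: ler_pM; rewrite ?invr_ge0 ?mulr_ge0 ?(ltW P0) ?(ltW d0) //; lra.
Qed.

Lemma normr_nega_term (R : realType) (d e : nat -> nat) (n : nat) :
  base_seq d ->
  `|nega_term R d e n| = (e n)%:R / (dprod d n)%:R.
Proof.
move=> hd; rewrite /nega_term !normrM normrX normrN1 expr1n mul1r.
by rewrite normr_nat ger0_norm // invr_ge0 ler0n.
Qed.

Lemma nega_psum_is_cvg (R : realType) (d e : nat -> nat) :
  base_seq d -> nega_digits d e -> cvgn (nega_psum R d e).
Proof.
move=> hd he; rewrite nega_psum_series; apply: normed_cvg.
apply: nondecreasing_is_cvgn.
  apply/nondecreasing_seqP => n.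
  by rewrite /series /= [leRHS]big_nat_recr //= lerDl.
exists 1 => _ [N _ <-].
have : \sum_(0 <= k < N) `|nega_term R d e k.+1| <= 1 - (dprod d N)%:R^-1.
  elim: N => [|N IH]; first by rewrite big_geq // dprod0 invr1 subrr.
  rewrite big_nat_recr //= normr_nega_term //.
  by have := nega_digit_le R d e N hd he; lra.
move=> /le_trans; apply.
by rewrite gerBl invr_ge0 ler0n.
Qed.

Lemma nega_psum_cvg (R : realType) (d e : nat -> nat) :
  base_seq d -> nega_digits d e ->
  nega_psum R d e @ \oo --> nega_value R d e.
Proof.
move=> hd he; have [l hl] : exists l : R, nega_psum R d e @ \oo --> l.
  by exists (limn (nega_psum R d e)); apply: nega_psum_is_cvg.
suff -> : nega_value R d e = l by [].
apply: cvg_lim => //.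
by rewrite -cvg_shiftS.
Qed.

Lemma unit_digits (d : nat -> nat) :
  base_seq d -> nega_digits d (fun=> 1%N).
Proof. by move=> hd n n1; apply: hd. Qed.

(** The number [a0] is the opposite of the value of the digits [1, 1, ...], so
    that facts on values of digits apply to it. *)
Lemma a0E (R : realType) (d : nat -> nat) :
  base_seq d -> a0 R d = - nega_value R d (fun=> 1%N).
Proof.
move=> hd; apply: cvg_lim => //.
rewrite -cvg_shiftS.
rewrite (eq_cvg _ _ (g := fun N => - nega_psum R d (fun=> 1%N) N)).
  exact: cvgN (nega_psum_cvg R d _ hd (unit_digits d hd)).
move=> N; rewrite /nega_psum -sumrN; apply: eq_bigr => n _.
by rewrite /nega_term mulr1 exprS mulN1r mulNr.
Qed.

Lemma dprod_inv_cvg0 (R : realType) (d : nat -> nat) :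
  base_seq d -> (fun n => (dprod d n)%:R^-1 : R) @ \oo --> (0 : R).
Proof.
move=> hd; rewrite -cvg_shiftS.
have := nega_psum_is_cvg R d _ hd (unit_digits d hd).
rewrite nega_psum_series => /cvg_series_cvg_0/cvg_norm.
rewrite normr0.
rewrite (eq_cvg _ _ (g := fun n => (dprod d n.+1)%:R^-1)) // => n.
by rewrite normr_nega_term // mul1r.
Qed.

(** * The range of the values *)

(** The upper bound is the partial sum with digit [d_n - 1] at even ranks and
    [0] at odd ranks, which telescopes to the partial sum
    [- nega_psum R d (fun=> 1) N] of [a0], corrected by [- 1 / (d_1 ... d_N)]
    for odd [N]; the lower bound exchanges the roles of even and odd ranks. *)
Lemma nega_psum_itv (R : realType) (d e : nat -> nat) (N : nat) :
  base_seq d -> nega_digits d e ->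
  let B := - nega_psum R d (fun=> 1%N) N - (odd N)%:R / (dprod d N)%:R in
  B - 1 + (dprod d N)%:R^-1 <= nega_psum R d e N <= B.
Proof.
move=> hd he /=; elim: N => [|N].
  by rewrite !nega_psum0 dprod0 /=; apply/andP; split; lra.
rewrite !nega_psumS /nega_term -signr_odd /= => /andP[IHl IHu].
have := nega_digit_le R d e N hd he.
have : 0 <= (e N.+1)%:R / (dprod d N.+1)%:R :> R.
  by rewrite divr_ge0 ?ler0n.
move: IHl IHu; case: (odd N) => /=;
  rewrite ?expr0 ?expr1 ?mulN1r ?mul1r ?mul0r ?mulNr ?mulr1 => *;
  apply/andP; split; lra.
Qed.

Lemma nega_value_itv (R : realType) (d e : nat -> nat) :
  base_seq d -> nega_digits d e ->
  a0 R d - 1 <= nega_value R d e <= a0 R d.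
Proof.
move=> hd he.
have cv := nega_psum_cvg R d e hd he.
have cvN1 : (- nega_psum R d (fun=> 1%N)) @ \oo -->
    - nega_value R d (fun=> 1%N).
  exact: cvgN (nega_psum_cvg R d _ hd (unit_digits d hd)).
have P0 N : 0 <= (dprod d N)%:R^-1 :> R by rewrite invr_ge0 ler0n.
have itv N : - nega_psum R d (fun=> 1%N) N - 1 <= nega_psum R d e N
             <= - nega_psum R d (fun=> 1%N) N.
  have /= := nega_psum_itv R d e N hd he; have := P0 N.
  by case: (odd N) => /= ? /andP[? ?]; apply/andP; split; lra.
rewrite a0E //; apply/andP; split.
  have cvB1 : (- nega_psum R d (fun=> 1%N) - cst 1) @ \oo -->
      - nega_value R d (fun=> 1%N) - 1 by apply: cvgB => //; exact: cvg_cst.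
  apply: (ler_cvg_to cvB1 cv).
  by apply: nearW => N /=; case/andP: (itv N).
apply: (ler_cvg_to cv cvN1).
by apply: nearW => N /=; case/andP: (itv N).
Qed.

Lemma a0_itv (R : realType) (d : nat -> nat) :
  base_seq d -> 0 <= a0 R d <= 1.
Proof.
move=> hd.
have he : nega_digits d (fun=> 0%N).
  by move=> n /hd; apply: leq_trans.
have v0 : nega_value R d (fun=> 0%N) = 0.
  apply: cvg_lim => //.
  rewrite [X in X @ _ --> _](_ : _ = fun=> 0); first exact: cvg_cst.
  by apply/funext => N; rewrite big1 // => n _; rewrite mulr0 mul0r.
by have := nega_value_itv R d _ hd he; rewrite v0; lra.
Qed.

(** * Stripping the first digit *)

Lemma nega_psum_recl (R : realType) (d e : nat -> nat) (N : nat) :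
  base_seq d ->
  nega_psum R d e N.+1 =
  - ((e 1%N)%:R + nega_psum R (fun n => d n.+1) (fun n => e n.+1) N)
    / (d 1%N)%:R.
Proof.
move=> hd; have d1 := base_gt0 R d 1 hd isT.
rewrite /nega_psum big_nat_recl // /nega_term dprod_recl dprod0 muln1.
rewrite expr1 mulN1r !mulNr mulrDl opprD; congr (_ + _).
rewrite mulr_suml -sumrN; apply: eq_bigr => n _.
by rewrite dprod_recl natrM invfM exprS; ring.
Qed.

Lemma nega_value_recl (R : realType) (d e : nat -> nat) :
  base_seq d -> nega_digits d e ->
  nega_value R d e =
  - ((e 1%N)%:R + nega_value R (fun n => d n.+1) (fun n => e n.+1))
    / (d 1%N)%:R.
Proof.
move=> hd he; rewrite -(cvg_lim (@Rhausdorff R) (nega_psum_cvg R d e hd he)).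
apply: cvg_lim => //.
rewrite -cvg_shiftS; under eq_fun do rewrite nega_psum_recl //.
apply: cvgMr_tmp; apply: cvgN; apply: cvgD; first exact: cvg_cst.
by apply: nega_psum_cvg; [apply: base_seq_shift|apply: nega_digits_shift].
Qed.

Lemma a0_recl (R : realType) (d : nat -> nat) :
  base_seq d -> a0 R d = (1 - a0 R (fun n => d n.+1)) / (d 1%N)%:R.
Proof.
move=> hd; rewrite !a0E //; last exact: base_seq_shift.
rewrite nega_value_recl //.
by rewrite opprK mulNr opprK.
Qed.

(** * Existence of representations *)

(** Greedy step: a first digit can be chosen so that the remainder lies in the
    interval attached to the shifted bases. *)
Lemma greedy_digit (R : realType) (d : nat -> nat) (y : R) :
  base_seq d -> a0 R d - 1 <= y <= a0 R d ->
  exists k, (k < d 1%N)%N /\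
    a0 R (fun n => d n.+1) - 1 <= - (d 1%N)%:R * y - k%:R
      <= a0 R (fun n => d n.+1).
Proof.
move=> hd; rewrite a0_recl //; set a := a0 R _.
have d1 := base_gt0 R d 1 hd isT.
have d2 : (0 < d 1)%N by apply: leq_trans (hd 1%N isT).
rewrite lerBlDr ler_pdivrMr // ler_pdivlMr // mulrDl mul1r => /andP[yl yu].
pose z := - (d 1%N)%:R * y - a + 1.
have z0 : 0 <= z by rewrite /z; lra.
have [zd|dz] := ltP z (d 1%N)%:R.
  have /andP[tl tu] := truncn_itv z0.
  exists (Num.truncn z); split.
    by rewrite -(ltr_nat R); apply: le_lt_trans zd.
  by move: tl tu; rewrite /z -natr1 => *; apply/andP; split; lra.
(* Here [z = d_1], and the truncation of [z] would not be a digit. *)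
exists (d 1%N).-1; split; first by rewrite prednK.
have -> : (d 1%N).-1%:R = (d 1%N)%:R - 1 :> R by rewrite -subn1 natrB.
by move: dz; rewrite /z => *; apply/andP; split; lra.
Qed.

(** Every number of [[a0 - 1; a0]] has a nega-D representation. *)
Lemma nega_repr_exists (R : realType) (d : nat -> nat) (x : R) :
  base_seq d -> a0 R d - 1 <= x <= a0 R d -> exists e, nega_repr d e x.
Proof.
move=> hd hx; pose dk k := fun n => d (k + n)%N.
have hdk k : base_seq (dk k).
  by move=> n n1; apply: hd; rewrite addn_gt0 n1 orbT.
have dkS k : (fun n => dk k n.+1) = dk k.+1.
  by apply/funext => n; rewrite /dk addnS.
pose I k (y : R) := a0 R (dk k) - 1 <= y <= a0 R (dk k).
have step (ky : nat * R) : exists m, I ky.1 ky.2 ->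
    (m < d ky.1.+1)%N /\ I ky.1.+1 (- (d ky.1.+1)%:R * ky.2 - m%:R).
  have [Iky|?] := pselect (I ky.1 ky.2); last by exists 0%N.
  have [m] := greedy_digit R _ _ (hdk ky.1) Iky.
  by rewrite dkS /dk addn1; exists m.
have [g gP] := choice step.
(* [r n] is the remainder left after [n] digits. *)
pose r := fix r n := if n is k.+1
  then - (d k.+1)%:R * r k - (g (k, r k))%:R else x.
have rI n : I n (r n).
  by elim: n => [|n IH] //=; case: (gP (n, r n) IH).
pose e n := g (n.-1, r n.-1).
have he : nega_digits d e.
  by move=> [//|n] _; case: (gP (n, r n) (rI n)).
have psumE N : nega_psum R d e N = x - (-1) ^+ N * r N / (dprod d N)%:R.
  elim: N => [|N IH].
    by rewrite nega_psum0 dprod0 expr0 mul1r divr1 subrr.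
  rewrite nega_psumS IH /nega_term dprodS natrM exprS /= /e /=.
  by field; rewrite !gt_eqF ?dprod_gt0 ?base_gt0.
exists e; split=> //.
rewrite -(cvg_lim (@Rhausdorff R) (nega_psum_cvg R d e hd he)).
apply: cvg_lim => //.
rewrite -[X in _ --> X]subr0 (funext psumE).
apply: cvgB; first exact: cvg_cst.
have Pcv := dprod_inv_cvg0 R d hd.
apply: (squeeze_cvgr _ _ Pcv); last first.
  by rewrite -[X in _ --> X]oppr0; exact: cvgN Pcv.
apply: nearW => N /=; rewrite -ler_norml normrM normrM normrX normrN1 expr1n.
rewrite mul1r [X in _ * X]ger0_norm ?invr_ge0 ?ler0n //.
rewrite ler_piMl ?invr_ge0 ?ler0n // ler_norml.
have := a0_itv R _ (hdk N); have := rI N; rewrite /I.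
by move=> /andP[? ?] /andP[? ?]; apply/andP; split; lra.
Qed.

(** * First digit and shift *)

(** The first digit locates [x] in a closed interval of length [1 / d_1]; two
    distinct digits give intervals with at most an endpoint in common. *)
Lemma first_digit_itv (R : realType) (d e : nat -> nat) (x : R) :
  base_seq d -> nega_repr d e x ->
  let a := a0 R (fun n => d n.+1) in
  (- (e 1%N)%:R - a) / (d 1%N)%:R <= x <= (1 - (e 1%N)%:R - a) / (d 1%N)%:R.
Proof.
move=> hd [he <-] /=; have d1 := base_gt0 R d 1 hd isT.
rewrite nega_value_recl // !ler_pM2r ?invr_gt0 //.
have := nega_value_itv R _ _ (base_seq_shift d hd) (nega_digits_shift d e he).
by move=> /andP[? ?]; apply/andP; split; lra.
Qed.

Lemma shift_mapE (R : realType) (d : nat -> nat) (dig : R -> nat -> nat)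
    (x : R) :
  base_seq d -> nega_repr d (dig x) x ->
  shift_map d dig x = - (dig x 1%N)%:R - (d 1%N)%:R * x.
Proof.
move=> hd [he xE]; have d1 := base_gt0 R d 1 hd isT.
have -> : - (dig x 1%N)%:R - (d 1%N)%:R * x =
    nega_value R (fun n => d n.+1) (fun n => dig x n.+1).
  by rewrite -{2}xE nega_value_recl //; field; rewrite gt_eqF.
apply: cvg_lim => //.
rewrite -cvg_shiftS -cvg_shiftS.
rewrite (eq_cvg _ _ (g := nega_psum R (fun n => d n.+1)
  (fun n => dig x n.+1))).
  by apply: nega_psum_cvg; [apply: base_seq_shift|apply: nega_digits_shift].
move=> N; rewrite /nega_psum [LHS]big_add1; apply: eq_bigr => n _.
by rewrite /nega_term /dprod [in LHS]big_add1.
Qed.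

Theorem theorem2 (R : realType) (d : nat -> nat)
  (hd : forall n : nat, (1 <= n)%N -> (2 <= d n)%N)
  (dig : R -> nat -> nat) (hdig : digit_selection d dig)
  (c : nat) (hc : (c < d 1)%N) :
  {in `]inf (cylinder R d c), sup (cylinder R d c)[ &,
    {homo shift_map d dig : x y /~ x < y}}.
Proof.
have d1 := base_gt0 R d 1 hd isT.
suff shiftE x : x \in `]inf (cylinder R d c), sup (cylinder R d c)[ ->
    shift_map d dig x = - c%:R - (d 1%N)%:R * x.
  move=> x y /shiftE -> /shiftE -> xy.
  by rewrite ltrD2l ltrN2 ltr_pM2l.
rewrite in_itv /= => /andP[infx xsup].
pose a := a0 R (fun n => d n.+1).
have [C0|/nonemptyPn C0] := pselect (cylinder R d c !=set0); last first.
  by move: infx xsup; rewrite C0 inf0 sup0 => ? ?; lra.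
have cylE y : cylinder R d c y ->
    [/\ a0 R d - 1 <= y <= a0 R d, (- c%:R - a) / (d 1%N)%:R <= y
      & y <= (1 - c%:R - a) / (d 1%N)%:R].
  move=> [yI [e [ey <-]]].
  by have /andP[? ?] := first_digit_itv R d e y hd ey.
have lo : (- c%:R - a) / (d 1%N)%:R < x.
  by apply: le_lt_trans infx; apply: lb_le_inf => // y /cylE[].
have up : x < (1 - c%:R - a) / (d 1%N)%:R.
  by apply: lt_le_trans xsup _; apply: ge_sup => // y /cylE[].
have xI : a0 R d - 1 <= x <= a0 R d.
  apply/andP; split.
    by apply/ltW/(le_lt_trans _ infx)/lb_le_inf => // y /cylE[/andP[]].
  by apply/ltW/(lt_le_trans xsup)/ge_sup => // y /cylE[/andP[]].
have xrepr : nega_repr d (dig x) x.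
  by apply: hdig; [rewrite in_itv|apply: nega_repr_exists].
have /andP[] := first_digit_itv R d _ x hd xrepr; rewrite -/a.
rewrite shift_mapE //.
move: lo up; rewrite !(ltr_pdivrMr, ltr_pdivlMr, ler_pdivrMr, ler_pdivlMr) //.
move=> lo up dlo dup; suff -> : dig x 1%N = c by [].
(* The two digits differ by less than [1]. *)
apply/eqP; rewrite eqn_leq; apply/andP; split.
  by rewrite -ltnS -(ltr_nat R) -natr1; lra.
by rewrite -ltnS -(ltr_nat R) -natr1; lra.
Qed.
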